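(* Let $\Delta\ge3$ be an integer. If $G$ is a finite loopless multigraph with maximum degree $\Delta(G)\le\Delta$ and no connected component of $G$ is isomorphic to the simple graph $K_{\Delta,\Delta}$, then $$q_B(G)\le\Delta(\Delta-1).$$
   Context: Multigraphs are loopless and may have parallel edges; degrees are counted with multiplicity, and $\Delta(G)$ is the maximum degree. A $4$-cycle has four distinct vertices (and four edges); in a multigraph, different choices of parallel edges may determine distinct $4$-cycles. A $B$-coloring of $G$ is a proper edge-coloring (any two distinct edges sharing an endpoint, in particular any two parallel edges, receive distinct colors) in which the edges of every $4$-cycle receive four distinct colors; $q_B(G)$ is the minimum number of colors in a $B$-coloring of $G$. *)

(* Defs.v *)
From mathcomp Require Import all_boot.
Set Implicit Arguments.
Unset Strict Implicit.
Unset Printing Implicit Defensive.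

(* Edges have an identity of their own, so distinct edges may have the same
   ends; two distinct ends for every edge means that there are no loops. *)
Record multigraph := Multigraph {
  vertex :> finType;
  edge : finType;
  ends : edge -> {set vertex};
  card_ends : forall e, #|ends e| = 2
}.

Section Multigraph.
Variable G : multigraph.
Implicit Types (x y : G) (e f : edge G).

Definition degree x : nat := #|[set e | x \in ends e]|.

Definition max_degree : nat := \max_(x : G) degree x.

Definition adjacent : rel G := [rel x y | [exists e, ends e == [set x; y]]].

Definition component x : {set G} := [set y | connect adjacent x y].

Section Induced.
Variable S : {set G}.

Definition induced_ends (e : {e : edge G | ends e \subset S}) :
    {set {x : G | x \in S}} :=
  [set x | val x \in ends (val e)].

Lemma card_induced_ends (e : {e : edge G | ends e \subset S}) :
  #|induced_ends e| = 2.
Proof.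
rewrite -(card_ends (val e)) -(card_imset _ val_inj).
apply: eq_card => x; apply/imsetP/idP => [[y] | xe].
  by rewrite inE => ye ->.
by exists (Sub x (subsetP (valP e) x xe)); rewrite ?inE SubK.
Qed.

Definition induced : multigraph := Multigraph card_induced_ends.

End Induced.

Definition proper_coloring (C : eqType) (c : edge G -> C) : bool :=
  [forall e, forall f,
     (e != f) && (ends e :&: ends f != set0) ==> (c e != c f)].

Definition four_cycle (x0 x1 x2 x3 : G) (e0 e1 e2 e3 : edge G) : bool :=
  [&& uniq [:: x0; x1; x2; x3],
      ends e0 == [set x0; x1], ends e1 == [set x1; x2],
      ends e2 == [set x2; x3] & ends e3 == [set x3; x0]].

Lemma four_cycle_uniq x0 x1 x2 x3 e0 e1 e2 e3 :
  four_cycle x0 x1 x2 x3 e0 e1 e2 e3 -> uniq [:: e0; e1; e2; e3].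
Proof.
move=> /and5P[ux /eqP h0 /eqP h1 /eqP h2 /eqP h3].
move: ux; rewrite /= !inE !negb_or andbT.
move=> /and3P[/and3P[n01 n02 n03] /andP[n12 n13] n23].
have ne (e f : edge G) x : x \in ends e -> x \notin ends f -> e != f.
  by move=> xe; apply: contraNneq => <-.
rewrite andbT; apply/and3P; split; [apply/and3P; split | apply/andP; split |].
- by apply: (ne _ _ x0); rewrite ?h0 ?h1 !inE ?eqxx // negb_or n01.
- by apply: (ne _ _ x0); rewrite ?h0 ?h2 !inE ?eqxx // negb_or n02.
- by apply: (ne _ _ x1); rewrite ?h0 ?h3 !inE ?eqxx ?orbT // negb_or n13 eq_sym n01.
- by apply: (ne _ _ x1); rewrite ?h1 ?h2 !inE ?eqxx // negb_or n12.
- by apply: (ne _ _ x1); rewrite ?h1 ?h3 !inE ?eqxx // negb_or n13 eq_sym n01.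
- by apply: (ne _ _ x2); rewrite ?h2 ?h3 !inE ?eqxx // negb_or n23 eq_sym n02.
Qed.

Definition B_coloring (C : eqType) (c : edge G -> C) : bool :=
  proper_coloring c &&
  [forall x0, forall x1, forall x2, forall x3,
   forall e0, forall e1, forall e2, forall e3,
     four_cycle x0 x1 x2 x3 e0 e1 e2 e3 ==>
       uniq [:: c e0; c e1; c e2; c e3]].

Definition B_colorable (k : nat) : bool :=
  [exists c : {ffun edge G -> 'I_k}, B_coloring c].

Lemma B_colorable_ex : exists k, B_colorable k.
Proof.
exists #|edge G|; apply/existsP; exists [ffun e => enum_rank e].
have inj_c : injective [ffun e : edge G => enum_rank e].
  by move=> e f; rewrite !ffunE => /enum_rank_inj.
apply/andP; split.
  apply/forallP => e; apply/forallP => f; apply/implyP => /andP[ef _].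
  by rewrite (inj_eq inj_c).
apply/forallP => x0; apply/forallP => x1; apply/forallP => x2.
apply/forallP => x3; apply/forallP => e0; apply/forallP => e1.
apply/forallP => e2; apply/forallP => e3; apply/implyP => h.
by rewrite (map_inj_uniq inj_c [:: e0; e1; e2; e3]) (four_cycle_uniq h).
Qed.

Definition q_B : nat := ex_minn B_colorable_ex.

End Multigraph.

Definition isomorphic (G H : multigraph) : Prop :=
  exists (f : G -> H) (g : edge G -> edge H),
    [/\ bijective f, bijective g & forall e, ends (g e) = f @: ends e].

Section CompleteBipartite.
Variables m n : nat.

Definition complete_bipartite_ends (e : 'I_m * 'I_n) : {set 'I_m + 'I_n} :=
  [set inl e.1; inr e.2].

Lemma card_complete_bipartite_ends (e : 'I_m * 'I_n) :
  #|complete_bipartite_ends e| = 2.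
Proof. by rewrite cards2. Qed.

Definition complete_bipartite : multigraph :=
  Multigraph card_complete_bipartite_ends.

End CompleteBipartite.

(* Main.v *)
(* Say that two distinct edges conflict when they must receive distinct colors.
   The edges that equal or conflict with e = uv are exactly those joining N(u) to
   N(v).  Put k = D(D-1).  If |N(x)| < D, at most k edges join N(x) to any other
   neighborhood, so the edges at x are light: they have fewer than k conflicts.
   An edge e with more than k conflicts always conflicts with so many edges q,
   each light or with exactly k conflicts one of which is light, that e can be
   colored greedily before those; the only obstruction is a K_{D,D} component.
   What resists greedy coloring is therefore a k-regular connected component of
   the conflict graph.  It is not a clique, since D does not divide
   2(D(D-1)+1), and Brooks' theorem colors it. *)
Require Import Defs.
From mathcomp Require Import all_boot.
From mathcomp Require Import zify.
Set Implicit Arguments.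
Unset Strict Implicit.
Unset Printing Implicit Defensive.

(** * Greedy coloring with [k] colors *)

Section Coloring.
Variables (T : finType) (h : rel T) (k : nat).
Hypotheses (h_sym : symmetric h) (h_irr : irreflexive h).
Implicit Types (S U V C : {set T}) (c : T -> nat).

Definition neighbors x := [set y | h x y].

(** A total function constrained only on [S], so that extending a partial coloring means changing
    one value. *)
Definition coloring_on S c : Prop :=
  {in S, forall x, c x < k} /\ {in S &, forall x y, h x y -> c x != c y}.

Lemma free_color (M : {set T}) c :
  #|M| < k -> exists2 t, t < k & {in M, forall y, c y != t}.
Proof.
move=> Mk; case: (boolP (all (mem (map c (enum M))) (iota 0 k))) => [sub|].
  have := uniq_leq_size (iota_uniq 0 k) (allP sub).
  by rewrite size_iota size_map -cardE leqNgt Mk.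
case/allPn => t; rewrite mem_iota /= => tk tM; exists t => // y yM.
by apply: contraNneq tM => <-; rewrite map_f // mem_enum.
Qed.

Lemma extend_coloring S c x t :
  coloring_on S c -> t < k -> {in S, forall y, h x y -> c y != t} ->
  coloring_on (x |: S) (fun z => if z == x then t else c z).
Proof.
move=> [ck cp] tk ct; split=> [z|y z]; rewrite !inE.
  by case: eqP => //= _; apply: ck.
case: (eqVneq y x) => [->|_] /=; case: (eqVneq z x) => [->|_] //= yS zS.
- by rewrite h_irr.
- by move=> xz; rewrite eq_sym; apply: ct.
- by rewrite h_sym => xy; apply: ct.
- exact: cp.
Qed.

(** A vertex with fewer than [k] neighbors in what remains is set aside and colored last. Agreement
    with [c] on [S] is recorded because [extend_connected] relies on two equal colors there. *)
Lemma greedy_extension S U c :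
  coloring_on S c -> [disjoint S & U] ->
  (forall V, V \subset U -> V != set0 ->
     exists2 x, x \in V & #|neighbors x :&: (S :|: V)| < k) ->
  exists2 c', coloring_on (S :|: U) c' & {in S, c' =1 c}.
Proof.
move=> cS; have [n] := ubnP #|U|; elim: n U => // n IH U Un dSU degen.
have [->|U0] := eqVneq U set0; first by rewrite setU0; exists c.
have [x xU xk] := degen U (subxx _) U0.
have subU : U :\ x \subset U by apply: subD1set.
have [||V VU|c' cS' c'c] := IH (U :\ x).
- by move: Un; rewrite (cardsD1 x) xU; lia.
- by apply: disjointWr dSU.
- by apply: degen; apply: subset_trans VU _.
have xS : x \notin S by apply/negP => xS; move/disjointFr: dSU => /(_ _ xS); rewrite xU.
have [|t tk tM] := @free_color (neighbors x :&: (S :|: U :\ x)) c'.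
  apply: leq_ltn_trans xk; apply: subset_leq_card.
  by apply: setIS; apply: setUS.
exists (fun z => if z == x then t else c' z).
  have -> : S :|: U = x |: (S :|: U :\ x) by rewrite setUCA setD1K.
  by apply: extend_coloring => // y yS xy; apply: tM; rewrite !inE xy -in_setD1 -in_setU.
by move=> y yS; case: eqP => [yx|_]; [rewrite -yx yS in xS | apply: c'c].
Qed.

(* Removing [x] leaves [U] degenerate because [U] is connected; [x] itself sees
   a repeated color, at [u] and [y]. *)
Lemma extend_connected S U c x u y :
  coloring_on S c -> [disjoint S & U] -> x \in U ->
  {in U, forall z, #|neighbors z| <= k} ->
  (forall V, V \subset U -> V != set0 ->
     (forall z w, z \in V -> w \in U -> h z w -> w \in V) -> x \in V) ->
  u \in S -> y \in S -> u != y -> h x u -> h x y -> c u = c y ->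
  exists c', coloring_on (S :|: U) c'.
Proof.
move=> cS dSU xU degk conn uS yS uy xu xy cuy.
have [|V VU V0|c' cS' c'c] := greedy_extension (U := U :\ x) cS.
- by apply: disjointWr dSU; apply: subD1set.
- have [Vx VU'] : x \notin V /\ V \subset U.
    by split; [apply/negP => /(subsetP VU); rewrite !inE eqxx | apply: subset_trans VU (subD1set _ _)].
  case: (boolP [exists z in V, #|neighbors z :&: (S :|: V)| < k]) => [/exists_inP[z zV zk]|].
    by exists z.
  (* If all vertices of [V] had [k] neighbors in [S :|: V], none would have a neighbor in the rest
     of [U]; by connectedness [V] would contain [x], which was removed. *)
  rewrite negb_exists_in => /forall_inP full; case/negP: Vx; apply: conn => // z w zV wU zw.
  have zk := full z zV; rewrite -leqNgt in zk.
  have: neighbors z \subset S :|: V.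
    apply/setIidPl/eqP; rewrite eqEcard subsetIl.
    by apply: leq_trans zk; apply: degk; apply: (subsetP VU').
  move/subsetP/(_ w); rewrite !inE zw => /(_ isT) /orP[wS|//].
  by move/disjointFr: dSU => /(_ _ wS); rewrite wU.
have [|t tk tM] := @free_color (neighbors x :\ u) c'.
  by have := degk x xU; rewrite (cardsD1 u (neighbors x)) inE xu; lia.
have xS : x \notin S by apply/negP => xS; move/disjointFr: dSU => /(_ _ xS); rewrite xU.
exists (fun z => if z == x then t else c' z).
have -> : S :|: U = x |: (S :|: U :\ x) by rewrite setUCA setD1K.
apply: extend_coloring => // z zS xz; case: (eqVneq z u) => [->|zu].
  by rewrite c'c // cuy -c'c // tM // !inE xy eq_sym uy.
by apply: tM; rewrite !inE zu.
Qed.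

Lemma path_closed U V x s :
  path h x s -> {subset x :: s <= U} ->
  (forall z w, z \in V -> w \in U -> h z w -> w \in V) ->
  forall z, z \in x :: s -> z \in V -> {subset x :: s <= V}.
Proof.
move=> ps sU clV.
have eqV : {in x :: s, forall z, (z \in V) = (x \in V)}.
  elim: s x ps sU => [|y s IH] x /= ps sU z; first by rewrite inE => /eqP ->.
  case/andP: ps => xy ps; rewrite inE => /orP[/eqP -> //|zs].
  rewrite (IH y) //; last by move=> w ws; apply: sU; rewrite inE ws orbT.
  by apply/idP/idP => ?; [apply: (clV y) | apply: (clV x)];
    rewrite ?sU ?inE ?eqxx ?orbT // h_sym.
by move=> z zs zV w ws; rewrite eqV // -(eqV z).
Qed.

(** Only the far end is extended, so the prescribed initial segment survives; Brooks' theorem needs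
    it for its nonadjacent first and third vertices. *)
Lemma maximal_path x s :
  path h x s -> uniq (x :: s) ->
  exists t, [/\ path h x (s ++ t), uniq (x :: s ++ t) &
    forall z, h (last x (s ++ t)) z -> z \in x :: s ++ t].
Proof.
have [n] := ubnP (#|T| - size s); elim: n s => // n IH s sn ps us.
case: (boolP [exists z, h (last x s) z && (z \notin x :: s)]) => [|none].
  case/existsP=> z /andP[lz zs].
  have us' : uniq (x :: rcons s z) by rewrite -rcons_cons rcons_uniq zs.
  have [||t [pt ut mt]] := IH (rcons s z) _ _ us'.
  - have := max_card (mem (x :: rcons s z)); rewrite (card_uniqP us') /= size_rcons.
    by move: sn; move: #|T| (size s) => m i; lia.
  - by rewrite rcons_path ps lz.
  by exists (z :: t); rewrite -cat_rcons.
exists [::]; rewrite cats0; split=> // z lz.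
by apply: contraNT none => zs; apply/existsP; exists z; rewrite lz.
Qed.

(** Induction on [U]: a vertex with fewer than [k] neighbors inside [U] is colored last; if there is
    none, a part [C] closed under adjacency splits off and is colored independently of the rest. *)
Lemma colorable_of_dense_sets :
  (forall V, V != set0 -> {in V, forall x, k <= #|neighbors x :&: V|} ->
     exists C, [/\ C \subset V, C != set0, {in C, forall x, neighbors x \subset C} &
                   exists c, coloring_on C c]) ->
  forall U, exists c, coloring_on U c.
Proof.
move=> dense U; have [n] := ubnP #|U|; elim: n U => // n IH U Un.
have [->|U0] := eqVneq U set0; first by exists (fun _ => 0); split=> [x|x y]; rewrite inE.
case: (boolP [exists x in U, #|neighbors x :&: U| < k]) => [/exists_inP[x xU xk]|full].
  have [|c cU] := IH (U :\ x); first by move: Un; rewrite (cardsD1 x) xU; lia.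
  have [|t tk tM] := @free_color (neighbors x :&: (U :\ x)) c.
    by apply: leq_ltn_trans xk; apply/subset_leq_card/setIS/subD1set.
  exists (fun z => if z == x then t else c z); rewrite -(setD1K xU).
  by apply: extend_coloring => // y yU xy; apply: tM; rewrite inE yU inE xy.
have [|C [CU C0 clC [c [ck cp]]]] := dense U U0.
  move: full; rewrite negb_exists_in => /forall_inP full x xU.
  by have := full x xU; rewrite -leqNgt.
have [|d [dk dp]] := IH (U :\: C).
  have /set0Pn[x xC] := C0; have : #|U :\: C| < #|U|; last by move: Un; lia.
  apply/proper_card/properP; split; first exact: subsetDl.
  by exists x; [apply: (subsetP CU) | rewrite inE xC].
exists (fun z => if z \in C then c z else d z); split=> [x xU|x y xU yU xy].
  by case: (boolP (x \in C)) => xC; [apply: ck | apply: dk; rewrite inE xC].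
have eqC : (x \in C) = (y \in C).
  by apply/idP/idP => zC; apply: (subsetP (clC _ zC)); rewrite inE // h_sym.
rewrite eqC; case: (boolP (y \in C)) => yC; first by apply: cp; rewrite ?eqC.
by apply: dp; rewrite // inE ?eqC yC.
Qed.

(** * Brooks' theorem for a connected [k]-regular graph *)

Section Brooks.
Variable C : {set T}.
Hypothesis k3 : 2 < k.
Hypothesis C_closed : {in C, forall x, neighbors x \subset C}.
Hypothesis C_connected :
  forall V, V \subset C -> V != set0 ->
  {in V, forall x, neighbors x \subset V} -> V = C.
Hypothesis C_regular : {in C, forall x, #|neighbors x| = k}.

(** Without such an induced path, [a] and its neighbors would be closed under adjacency, hence all
    of [C], which contains [b]. *)
Lemma nonadjacent_neighbors a b :
  a \in C -> b \in C -> a != b -> ~~ h a b ->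
  exists v1 v2 v3,
    [/\ v2 \in C, h v1 v2, h v2 v3, v1 != v3 & ~~ h v1 v3].
Proof.
move=> aC bC ab nab.
case: (boolP [exists v1, exists v2, exists v3,
  [&& v2 \in C, h v1 v2, h v2 v3, v1 != v3 & ~~ h v1 v3]]).
  move=> /existsP[v1 /existsP[v2 /existsP[v3 /and5P[]]]] *.
  by exists v1, v2, v3.
move=> none; have cl : a |: neighbors a = C.
  apply: C_connected; first by rewrite subUset sub1set aC C_closed.
    by apply/set0Pn; exists a; rewrite !inE eqxx.
  move=> x; rewrite !inE => /orP[/eqP ->|ax]; first exact: subsetUr.
  apply/subsetP => y; rewrite !inE => xy.
  apply: contraR none; rewrite negb_or => /andP[ya nay].
  apply/existsP; exists a; apply/existsP; exists x; apply/existsP; exists y.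
  rewrite ax xy nay eq_sym ya !andbT.
  by apply: (subsetP (C_closed aC)); rewrite inE.
by move: bC; rewrite -cl !inE (negPf nab) orbF eq_sym (negPf ab).
Qed.

(** Greedy coloring works: a subset of [C :\: D] whose vertices all have [k] neighbors inside it
    would be closed by regularity, hence equal to [C], yet it misses [D]. *)
Lemma color_proper_subset D :
  D != set0 -> D \subset C -> exists c, coloring_on (C :\: D) c.
Proof.
move=> /set0Pn[l lD] DC.
have c0 : coloring_on set0 (fun _ => 0) by split=> [x|x y]; rewrite inE.
have [|V VU V0|c cC _] := greedy_extension (U := C :\: D) c0.
- by rewrite -setI_eq0 set0I.
- have VC : V \subset C by apply: subset_trans VU (subsetDl _ _).
  case: (boolP [exists z in V, #|neighbors z :&: (set0 :|: V)| < k]) => [/exists_inP[z zV zk]|].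
    by exists z.
  rewrite negb_exists_in => /forall_inP full.
  have: V = C.
    apply: C_connected => // z zV; have := full z zV; rewrite -leqNgt set0U => zk.
    apply/setIidPl/eqP; rewrite eqEcard subsetIl.
    by rewrite C_regular // (subsetP VC).
  by move=> eVC; move/subsetP: VU => /(_ l); rewrite eVC !inE lD (subsetP DC) //= => /(_ isT).
by exists c; rewrite set0U in cC.
Qed.

(** [v1] and [v3] both get color 0, the repeated color at [v2]. As [k] exceeds 2, [v2] has a further
    neighbor on [s], which keeps the uncolored vertices connected. *)
Lemma color_hamiltonian v1 v2 v3 s :
  path h v1 [:: v2, v3 & s] -> uniq [:: v1, v2, v3 & s] -> ~~ h v1 v3 ->
  C = [set z in [:: v1, v2, v3 & s]] -> exists c, coloring_on C c.
Proof.
move=> /= /and3P[h12 h23 ps] us n13 eC.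
have memC z : (z \in C) = (z \in [:: v1, v2, v3 & s]) by rewrite eC inE.
have v2C : v2 \in C by rewrite memC !inE eqxx orbT.
have v13 : v1 != v3 by apply: contraTneq us => ->; rewrite /= !inE eqxx orbT.
pose S := [set v1; v3]; pose U := C :\: S.
have [z zv2 zS] : exists2 z, h v2 z & z \notin S.
  apply/exists_inP; apply: contraTT k3; rewrite negb_exists_in => /forall_inP sub.
  rewrite -leqNgt -(C_regular v2C) -(_ : #|S| = 2); last by rewrite cards2 v13.
  by apply: subset_leq_card; apply/subsetP => y; rewrite inE => /sub; rewrite negbK.
have memU w : (w \in U) = (w == v2) || (w \in s).
  rewrite !inE memC !inE; move: us; rewrite /= !inE !negb_or.
  move=> /and4P[/and3P[n12 _ v1s] /andP[v23 v2s] v3s _].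
  case: (eqVneq w v1) => [->|] /=; first by rewrite (negPf n12) (negPf v1s).
  by case: (eqVneq w v3) => [->|] //=; rewrite (eq_sym v3 v2) (negPf v23) (negPf v3s).
have zC : z \in C by apply: (subsetP (C_closed v2C)); rewrite inE.
have zs : z \in s.
  have : z \in U by rewrite inE zS zC.
  by rewrite memU => /orP[/eqP zv|//]; rewrite zv h_irr in zv2.
have cS : coloring_on S (fun _ => 0).
  split=> [x _|x y]; first by apply: leq_trans k3.
  by rewrite !inE => /orP[] /eqP -> /orP[] /eqP -> //; rewrite ?h_irr ?(negPf n13) // h_sym (negPf n13).
have [||y yU|V VU V0 clV||||||//|c cC] :=
  extend_connected (x := v2) (u := v1) (y := v3) (U := U) cS.
- by rewrite disjoints_subset; apply/subsetP => w wS; rewrite in_setC in_setD wS.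
- by rewrite memU eqxx.
- by rewrite C_regular //; move: yU; rewrite inE => /andP[].
- have /set0Pn[w wV] := V0; have := subsetP VU w wV; rewrite memU.
  case/orP=> [/eqP <- //|ws].
  apply: (clV z); rewrite ?memU ?eqxx //; last by rewrite h_sym.
  case: s ps us ws zs eC memC memU => //= x s /andP[_ ps] _ ws zs _ _ memU.
  apply: (path_closed ps _ clV ws wV) => //.
  by move=> y ys; rewrite memU ys orbT.
- by rewrite !inE eqxx.
- by rewrite !inE eqxx orbT.
- exact: v13.
- by rewrite h_sym.
- exact: h23.
exists c; suff -> : C = S :|: U by [].
apply/setP => w; rewrite in_setU in_setD.
have : w \in S -> w \in C by rewrite memC !inE => /orP[] ->; rewrite ?orbT.
by case: (w \in S) => //= /(_ isT) ->.
Qed.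

(* The predecessor [y] of [x] on the cycle has no neighbor outside the cycle, so
   it can take the color of a neighbor [u] of [x] outside. *)
Lemma color_cycle x s u :
  cycle h (x :: s) -> uniq (x :: s) -> {subset x :: s <= C} ->
  h x u -> u \notin x :: s ->
  neighbors (last x s) \subset [set z in x :: s] -> exists c, coloring_on C c.
Proof.
case: (lastP s) => [|q y] cyc us sC xu us' yD.
  by move/subsetP: yD => /(_ u); rewrite !inE /= => /(_ xu) ux; rewrite inE ux in us'.
pose D := [set z in x :: rcons q y].
have DC : D \subset C by apply/subsetP => z; rewrite inE => /sC.
have xC : x \in C by apply: sC; rewrite inE eqxx.
have uC : u \in C by apply: (subsetP (C_closed xC)); rewrite inE.
have [|c [ck cp]] := @color_proper_subset D _ DC.
  by apply/set0Pn; exists x; rewrite !inE eqxx.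
rewrite last_rcons in yD.
have yDD : y \in D by rewrite !inE mem_rcons inE eqxx orbT.
have uCD : u \in C :\: D by rewrite !inE uC us'.
pose c1 z := if z == y then c u else c z.
have cS : coloring_on (y |: C :\: D) c1.
  apply: extend_coloring => //; first exact: ck.
  move=> z; rewrite inE => /andP[zD _] yz; case/negP: zD.
  by apply: (subsetP yD); rewrite inE.
move: us; rewrite /= mem_rcons rcons_uniq inE negb_or.
move=> /and3P[/andP[xy xq] yq uq].
move: cyc; rewrite /= rcons_path last_rcons => /andP[].
rewrite rcons_path => /andP[pq _] yx.
pose U := D :\ y.
have memU z : (z \in U) = (z \in x :: q).
  rewrite !inE mem_rcons inE; case: (eqVneq z y) => [->|] //=.
  by rewrite eq_sym (negPf xy) (negPf yq).
have [||z zU|V VU V0 clV|||||||c' cC] :=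
  extend_connected (x := x) (u := u) (y := y) (U := U) cS.
- rewrite disjoints_subset; apply/subsetP => z.
  by rewrite in_setC in_setD1 in_setU1 in_setD; case: (z == y) => //= /andP[].
- by rewrite memU inE eqxx.
- rewrite C_regular //; apply: (subsetP DC); move: zU; rewrite inE => /andP[] //.
- have /set0Pn[w wV] := V0; have := subsetP VU w wV; rewrite memU => wq.
  by apply: (path_closed pq _ clV wq wV); rewrite ?inE ?eqxx // => z; rewrite memU.
- by rewrite inE uCD orbT.
- by rewrite !inE eqxx.
- by apply: contraTneq uCD => ->; rewrite inE yDD.
- exact: xu.
- by rewrite h_sym.
- by rewrite /c1 eqxx; case: eqP.
exists c'; suff -> : C = (y |: C :\: D) :|: U by [].
apply/setP => z; have := subsetP DC z; rewrite !(in_setU, in_setD, in_set1).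
case: (eqVneq z y) => [->|] /=; first by move=> /(_ yDD) ->.
by move=> _; case: (z \in D) => //= [/(_ isT) -> //|_]; rewrite orbF.
Qed.

(* Zajac's proof: a maximal path from [v1], [v2], [v3] ends at a vertex [l] whose
   neighbors all lie on the path; the part of the path from the first of them on
   is a cycle. *)
Lemma brooks a b :
  a \in C -> b \in C -> a != b -> ~~ h a b -> exists c, coloring_on C c.
Proof.
move=> aC bC ab nab.
have [v1 [v2 [v3 [v2C h12 h23 v13 n13]]]] := nonadjacent_neighbors aC bC ab nab.
have hne x y : h x y -> x != y by move=> xy; apply: contraTneq xy => ->; rewrite h_irr.
have [||s []] := @maximal_path v1 [:: v2; v3].
- by rewrite /= h12 h23.
- by rewrite /= !inE negb_or (hne _ _ h12) v13 (hne _ _ h23).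
pose p := [:: v1, v2, v3 & s]; pose l := last v1 p.
rewrite -[v1 :: _]/p => ps us ms.
have pC : {subset p <= C}.
  apply: (@path_closed [set: T] C v1 [:: v2, v3 & s] ps _ _ v2) => //.
  - by move=> z _; rewrite inE.
  - by move=> z w zC _ zw; apply: (subsetP (C_closed zC)); rewrite inE.
  - by rewrite !inE eqxx orbT.
have lC : l \in C by apply: pC; rewrite /l /= (mem_last v1 [:: v2, v3 & s]).
have hasl : has (h l) p.
  have /card_gt0P[z] : 0 < #|neighbors l| by rewrite C_regular // (leq_trans _ k3).
  by rewrite inE => lz; apply/hasP; exists z; rewrite ?ms.
have [r [d [q [ep ld lD]]]] : exists r d q, [/\ p = r ++ d :: q, h l d
    & forall z, h l z -> z \in d :: q].
  case/split_find: hasl ms us => d r q ld nr ms us; exists r, d, q; split=> //.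
    by rewrite -cat_rcons.
  move=> z lz; have := ms z lz; rewrite mem_cat mem_rcons !inE -orbA.
  by case/or3P=> [->|zr|->]; rewrite ?orbT //; case/negP: nr; apply/hasP; exists z.
have el : l = last d q.
  by have := congr1 (last v1) ep; rewrite last_cat.
have sD : {subset d :: q <= p} by move=> z; rewrite ep mem_cat => ->; rewrite orbT.
have cyc : cycle h (d :: q).
  rewrite /= rcons_path -el ld andbT.
  have : sorted h p by [].
  by rewrite ep; case/cat_sorted2.
have uD : uniq (d :: q) by move: us; rewrite ep cat_uniq => /and3P[].
pose out x := [exists u, h x u && (u \notin d :: q)].
have outN z : ~~ out z -> neighbors z \subset [set w in d :: q].
  rewrite negb_exists => /forallP zN; apply/subsetP => w; rewrite !inE => zw.
  by have := zN w; rewrite zw /= negbK inE.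
have outl : ~~ out l by apply/existsPn => u; apply/negP => /andP[/lD ->].
(* If no vertex of the cycle has a neighbor off it, the cycle, hence the path, covers [C]. Otherwise
   the cycle is rotated to start at its first vertex with such a neighbor. *)
case: (boolP (has out (d :: q))) => [hout|nout]; last first.
  apply: (color_hamiltonian ps us n13).
  have eC : [set w in d :: q] = C.
    apply: C_connected; first by apply/subsetP => z; rewrite inE => /sD/pC.
      by apply/set0Pn; exists d; rewrite !inE eqxx.
    move=> z; rewrite inE => zD; apply: outN.
    by apply: contra nout => oz; apply/hasP; exists z.
  by apply/setP => z; apply/idP/idP; rewrite inE; [rewrite -eC inE => /sD | move/pC].
have [x [s1 [s2 [eD ox ns1]]]] :
    exists x s1 s2, [/\ d :: q = s1 ++ x :: s2, out x & ~~ has out s1].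
  case/split_find: hout => x s1 s2 ox ns1.
  by exists x, s1, s2; rewrite -cat_rcons.
have eR : rot (size s1) (d :: q) = x :: (s2 ++ s1) by rewrite eD rot_size_cat.
have memR z : (z \in x :: (s2 ++ s1)) = (z \in d :: q) by rewrite -eR mem_rot.
have /existsP[u /andP[xu uD']] := ox.
apply: (@color_cycle x (s2 ++ s1) u) => //.
- by rewrite -eR rot_cycle.
- by rewrite -eR rot_uniq.
- by move=> z; rewrite memR => /sD/pC.
- by rewrite memR.
rewrite (_ : [set z in x :: s2 ++ s1] = [set w in d :: q]); last first.
  by apply/setP => z; rewrite in_set memR in_set.
(* The predecessor of [x] is the last vertex of [s1], or [l] if [s1] is empty; neither has a
   neighbor off the cycle. *)
apply: outN; case: (lastP s1) eD ns1 => [|s1' y] eD ns1.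
  by have /= := congr1 (last d) eD; rewrite cats0 => <-; rewrite -el.
rewrite last_cat last_rcons; apply: contra ns1 => oy.
by apply/hasP; exists y; rewrite ?mem_rcons ?inE ?eqxx.
Qed.

End Brooks.
End Coloring.

(** * Finite bijections, and an inequality *)

Lemma bijective_of_surj (A B : finType) (f : A -> B) :
  injective f -> (forall b, exists a, f a = b) -> bijective f.
Proof.
move=> inj_f /fin_all_exists[g gK]; exists g => // a.
by apply: inj_f; rewrite gK.
Qed.

Lemma set_ranking (T : finType) (A : {set T}) n x0 :
  x0 \in A -> #|A| = n ->
  exists r : T -> 'I_n, {in A &, injective r} /\ forall i, exists2 x, x \in A & r x = i.
Proof.
move=> x0A <-; exists (enum_rank_in x0A); split; first exact: enum_rank_in_inj.
by move=> i; exists (enum_val i); rewrite ?enum_valP ?enum_valK_in.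
Qed.

(** It amounts to [t * t <= D * (t - 1)], and (t + 2)(t - 1) = t^2 + t - 2 is at least t^2 once t >=
    2. *)
Lemma mul_sub_sqr_le D t : 1 < t -> t + 2 <= D -> D * (D - t) + t * t <= D * (D - 1).
Proof. by move=> t1 tD; rewrite (_ : D = t + 2 + (D - (t + 2))); [nia | lia]. Qed.

(** * Neighborhoods and edge counts in the multigraph *)

Section Conflicts.
Variable G : multigraph.
Implicit Types (x y u v : G) (e f : edge G) (A B : {set G}).

Definition nbrs x : {set G} := [set y | adjacent x y].

Definition edges_between A B : {set edge G} :=
  [set f | [exists x in A, exists y in B, ends f == [set x; y]]].

Lemma edges_betweenP A B f :
  reflect (exists x y, [/\ x \in A, y \in B & ends f = [set x; y]])
          (f \in edges_between A B).
Proof.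
rewrite inE; apply: (iffP exists_inP) => [[x xA /exists_inP[y yB /eqP]]|].
  by exists x, y.
by move=> [x [y [xA yB /eqP ef]]]; exists x => //; apply/exists_inP; exists y.
Qed.

Lemma edges_betweenC A B : edges_between A B = edges_between B A.
Proof.
apply/setP => f; apply/edges_betweenP/edges_betweenP => -[x [y [xA yB ef]]];
  by exists y, x; rewrite setUC.
Qed.

Lemma adjacentP x y : reflect (exists e, ends e = [set x; y]) (adjacent x y).
Proof. by apply: (iffP existsP) => -[e /eqP ee]; exists e. Qed.

Lemma adjacent_sym x y : adjacent x y = adjacent y x.
Proof. by rewrite /adjacent /= setUC. Qed.

Lemma ends_neq e x y : ends e = [set x; y] -> x != y.
Proof. by move=> ee; have := card_ends e; rewrite ee cards2; case: (x != y). Qed.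

Lemma adjacent_irr x : adjacent x x = false.
Proof. by apply/adjacentP => -[e /ends_neq]; rewrite eqxx. Qed.

Lemma nbrs_sym x y : (y \in nbrs x) = (x \in nbrs y).
Proof. by rewrite !inE -/(adjacent x y) adjacent_sym. Qed.

Lemma nbrs_irr x : (x \in nbrs x) = false.
Proof. by rewrite inE; apply: adjacent_irr. Qed.

Lemma ends_nbrs e x y : ends e = [set x; y] -> y \in nbrs x.
Proof. by move=> ee; rewrite inE; apply/adjacentP; exists e. Qed.

Lemma ends2 e x : x \in ends e -> exists y, ends e = [set x; y].
Proof.
have /cards2P[a [b [_ ee]]] : #|ends e| == 2 by rewrite card_ends.
by rewrite ee !inE => /orP[] /eqP ->; [exists b | exists a; rewrite setUC].
Qed.

Lemma set2_inj x y z : x != y -> [set x; y] = [set x; z] -> y = z.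
Proof.
by move=> xy /setP/(_ y); rewrite !inE eqxx orbT eq_sym (negPf xy) => /esym/eqP.
Qed.

Lemma card_edges_between_le A B :
  #|edges_between A B| <= \sum_(x in A) #|edges_between [set x] B|.
Proof.
have sub : edges_between A B \subset \bigcup_(x in A) edges_between [set x] B.
  apply/subsetP => f /edges_betweenP[x [y [xA yB ef]]]; apply/bigcupP; exists x => //.
  by apply/edges_betweenP; exists x, y; rewrite inE.
apply: leq_trans (subset_leq_card sub) _.
elim/big_rec2: _ => [|x n S _ le]; first by rewrite cards0.
by apply: leq_trans (leq_card_setU _ _) _; rewrite leq_add2l.
Qed.

Lemma edges_betweenUl A A' B :
  edges_between (A :|: A') B = edges_between A B :|: edges_between A' B.
Proof.
apply/setP => f; rewrite in_setU; apply/edges_betweenP/orP.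
  move=> [x [y [/setUP[xA|xA] yB ef]]]; [left|right]; apply/edges_betweenP; by exists x, y.
by move=> [] /edges_betweenP[x [y [xA yB ef]]]; exists x, y; rewrite inE xA ?orbT.
Qed.

Lemma card_nbrs_le x B : #|nbrs x :&: B| <= #|edges_between [set x] B|.
Proof.
rewrite -(card_in_imset (f := fun y => [set x; y])); last first.
  move=> y z; rewrite !inE => /andP[xy _] _; apply: set2_inj.
  by apply: contraTneq xy => <-; rewrite -/(adjacent x x) adjacent_irr.
rewrite -(card_imset _ (@enum_rank_inj _)).
apply: leq_trans (leq_imset_card (@ends G) _).
rewrite card_imset; last exact: enum_rank_inj.
apply/subset_leq_card/subsetP => _ /imsetP[y /setIP[+ yB] ->].
rewrite inE => /adjacentP[e ee]; apply/imsetP; exists e => //.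
by apply/edges_betweenP; exists x, y; rewrite inE.
Qed.

Lemma edges_between_degree x B : edges_between [set x] B \subset [set e | x \in ends e].
Proof.
by apply/subsetP => f /edges_betweenP[y [z [/set1P -> _ ef]]]; rewrite inE ef !inE eqxx.
Qed.

Variable D : nat.
Hypothesis maxD : max_degree G <= D.

(** [D] distinct neighbors use up the degree bound, so a full vertex has degree [D] and no parallel
    edges. *)
Definition full x := #|nbrs x| == D.

Lemma degree_le x : degree x <= D.
Proof. by apply: leq_trans maxD; apply: (leq_bigmax x). Qed.

Lemma card_edges_at_le x B : #|edges_between [set x] B| <= D.
Proof. exact: leq_trans (subset_leq_card (edges_between_degree x B)) (degree_le x). Qed.

Lemma card_nbrs_leD x : #|nbrs x| <= D.
Proof. by rewrite -[nbrs x]setIT; apply: leq_trans (card_nbrs_le _ _) (card_edges_at_le _ _). Qed.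

Lemma degree_full x : full x -> degree x = D.
Proof.
move=> /eqP fx; apply/eqP; rewrite eqn_leq degree_le /= -{1}fx -[nbrs x]setIT.
exact: leq_trans (card_nbrs_le _ _) (subset_leq_card (edges_between_degree x _)).
Qed.

(** At most [D] edges leave [x] towards [B] and its complement together, and the [D] neighbors
    already take one each, so none takes a second. *)
Lemma card_edges_full x B :
  full x -> #|edges_between [set x] B| <= #|nbrs x :&: B|.
Proof.
move=> /eqP fx; have := card_nbrs_le x (~: B); have := cardsID B (nbrs x).
rewrite setDE fx => eD leC.
have dis : [disjoint edges_between [set x] B & edges_between [set x] (~: B)].
  rewrite -setI_eq0; apply/eqP/setP => f; rewrite inE in_set0; apply/negP.
  case/andP=> /edges_betweenP[y [z [/set1P -> zB ef]]].
  case/edges_betweenP=> [y' [z' [/set1P -> zB' ef']]]; move: zB'.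
  by rewrite inE -(set2_inj (ends_neq ef) (etrans (esym ef) ef')) zB.
have := cardsU (edges_between [set x] B) (edges_between [set x] (~: B)).
rewrite (disjoint_setI0 dis) cards0 subn0 => eU.
have : #|edges_between [set x] B :|: edges_between [set x] (~: B)| <= D.
  apply: leq_trans (degree_le x); apply: subset_leq_card.
  by rewrite subUset !edges_between_degree.
by rewrite eU; lia.
Qed.

(** * The conflict relation on edges *)

(* Reflexive, so that the closed neighborhood of an edge is one [edges_between]. *)
Definition conflict e f : bool :=
  [exists u, exists v, (ends e == [set u; v]) && (f \in edges_between (nbrs u) (nbrs v))].

Lemma conflictE e u v f :
  ends e = [set u; v] -> conflict e f = (f \in edges_between (nbrs u) (nbrs v)).
Proof.
move=> ee; apply/existsP/idP => [[u' /existsP[v' /andP[/eqP ee']]]|fE]; last first.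
  by exists u; apply/existsP; exists v; rewrite ee eqxx.
have uv := ends_neq ee; have := set21 u v; rewrite -ee ee' => /set2P[eu|eu].
  by subst u'; rewrite -(set2_inj uv (etrans (esym ee) ee')).
subst v'; rewrite setUC in ee'.
by rewrite -(set2_inj uv (etrans (esym ee) ee')) edges_betweenC.
Qed.

Lemma conflict_sym : symmetric conflict.
Proof.
suff imp e f : conflict e f -> conflict f e by move=> e f; apply/idP/idP; apply: imp.
case/existsP=> u /existsP[v /andP[/eqP ee /edges_betweenP[y [x [uy vx ef]]]]].
rewrite (conflictE _ ef); apply/edges_betweenP; exists u, v.
by rewrite nbrs_sym uy nbrs_sym vx.
Qed.

Lemma conflict_share e f x : x \in ends e -> x \in ends f -> conflict e f.
Proof.
move=> /ends2[y ee] /ends2[z ef]; rewrite (conflictE _ ee); apply/edges_betweenP.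
exists z, x; rewrite setUC in ef; split=> //.
  by rewrite nbrs_sym (ends_nbrs ef).
by rewrite nbrs_sym (ends_nbrs ee).
Qed.

Lemma conflict_refl e : conflict e e.
Proof.
have /card_gt0P[x xe] : 0 < #|ends e| by rewrite card_ends.
exact: (conflict_share xe xe).
Qed.

Definition conflicts e := [set f | conflict e f].

Lemma conflictsE e u v :
  ends e = [set u; v] -> conflicts e = edges_between (nbrs u) (nbrs v).
Proof. by move=> ee; apply/setP => f; rewrite inE (conflictE _ ee). Qed.

Lemma conflicts_not_full e x :
  x \in ends e -> ~~ full x -> #|conflicts e| <= D * (D - 1).
Proof.
move=> /ends2[y ee] xF; have xD : #|nbrs x| < D by rewrite ltn_neqAle xF card_nbrs_leD.
rewrite (conflictsE ee); apply: leq_trans (card_edges_between_le _ _) _.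
apply: (@leq_trans (\sum_(z in nbrs x) D)).
  by apply: leq_sum => z _; apply: card_edges_at_le.
by rewrite sum_nat_const mulnC leq_mul2l; lia.
Qed.

(** * Double counting at full vertices, and dominated edges *)

Lemma card_edges_between_full A B :
  {in A, forall x, full x} ->
  #|edges_between A B| <= \sum_(x in A) #|nbrs x :&: B|.
Proof.
move=> fA; apply: leq_trans (card_edges_between_le _ _) _.
by apply: leq_sum => x xA; apply/card_edges_full/fA.
Qed.

Lemma card_nbrsI x B : #|nbrs x :&: B| = \sum_(y in B) (y \in nbrs x).
Proof.
rewrite -sum1_card (eq_bigl (fun y => (y \in B) && (y \in nbrs x))) ?big_mkcondr //.
by move=> y; rewrite in_setI andbC.
Qed.

Lemma sum_nbrsI A B : \sum_(x in A) #|nbrs x :&: B| = \sum_(y in B) #|nbrs y :&: A|.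
Proof.
rewrite (eq_bigr _ (fun x _ => card_nbrsI x B)) exchange_big /=.
by apply: eq_bigr => y _; rewrite card_nbrsI; apply: eq_bigr => x _; rewrite nbrs_sym.
Qed.

Lemma sum_nbrs_full A B : {in A, forall x, full x} ->
  \sum_(x in A) #|nbrs x :&: B| + \sum_(x in A) #|nbrs x :\: B| = #|A| * D.
Proof.
move=> fA; rewrite -big_split /= -sum_nat_const; apply: eq_bigr => x xA.
by rewrite cardsID; apply/eqP/fA.
Qed.

(** [conflicts e] contains [e], so a light edge has fewer than [D * (D - 1)] proper conflicts. *)
Definition light e := #|conflicts e| <= D * (D - 1).

Definition nearly_light e : Prop :=
  light e \/ #|conflicts e| <= D * (D - 1) + 1 /\ exists2 g, conflict e g & light g.

(** The edges of [Q] are to be colored after [e]; the bound leaves at most [D * (D - 1)] others in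
    [conflicts e], a count that includes [e]. *)
Definition dominated e : Prop :=
  exists Q : {set edge G}, [/\ Q \subset conflicts e,
    #|conflicts e| <= D * (D - 1) + #|Q| & {in Q, forall q, nearly_light q}].

(** [Q] consists of the edges from [y] to [nbrs v], light because [y] is not full; the at most
    [D - 1] other neighbors of [u] contribute at most [D] edges each. *)
Lemma dominated_not_full e u v y :
  ends e = [set u; v] -> y \in nbrs u -> ~~ full y -> dominated e.
Proof.
move=> ee yu yF; exists (edges_between [set y] (nbrs v)); split.
- apply/subsetP => f /edges_betweenP[z [x [/set1P -> xv ef]]].
  by rewrite (conflictsE ee); apply/edges_betweenP; exists y, x.
- rewrite (conflictsE ee); apply: leq_trans (card_edges_between_le _ _) _.
  rewrite (big_setD1 y) //= addnC leq_add2r.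
  apply: (@leq_trans (\sum_(z in nbrs u :\ y) D)).
    by apply: leq_sum => z _; apply: card_edges_at_le.
  rewrite sum_nat_const mulnC leq_mul2l; have := card_nbrs_leD u.
  by rewrite (cardsD1 y (nbrs u)) yu; lia.
move=> q /edges_betweenP[z [x [/set1P -> xv eq]]]; left.
by apply: conflicts_not_full yF; rewrite eq !inE eqxx.
Qed.

Hypothesis D3 : 2 < D.

(* The set [Q] consists of the edges from [a] to the vertices [x] of [nbrs v]
   with [nbrs x = nbrs u].  Maximality of [a] bounds the losses at the vertices of
   [nbrs v] that are not adjacent to [a].  If only one edge at [a] leaves
   [nbrs v], that edge is light. *)
Lemma dominated_full e u v a :
  ends e = [set u; v] -> full u -> full v ->
  {in nbrs u, forall y, full y} -> {in nbrs v, forall x, full x} ->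
  D * (D - 1) + 1 < #|conflicts e| ->
  a \in nbrs u -> 0 < #|nbrs a :\: nbrs v| ->
  {in nbrs v, forall x, #|nbrs x :\: nbrs u| <= #|nbrs a :\: nbrs v|} ->
  dominated e.
Proof.
move=> ee /eqP cY /eqP cX fY fX he aY t0 tmax.
set X := nbrs v in cX fX t0 tmax *; set Y := nbrs u in cY fY aY tmax *.
set t := #|nbrs a :\: X| in t0 tmax.
(* [d] is the number of nonadjacent pairs in the product of [Y] and [X], hence the same seen from
   [X]. Heaviness of [e] forces [d + 2 <= D]. *)
pose d := \sum_(y in Y) #|nbrs y :\: X|.
have sumY := sum_nbrs_full X fY; have sumX := sum_nbrs_full Y fX.
rewrite cY -/d in sumY; rewrite cX -sum_nbrsI in sumX.
have dX : \sum_(x in X) #|nbrs x :\: Y| = d by move: sumX sumY; lia.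
have he' : #|conflicts e| + d <= D * D.
  by rewrite -sumY leq_add2r (conflictsE ee); apply: card_edges_between_full.
have d2 : d + 2 <= D by move: he he'; nia.
have td : t <= d by rewrite /d (bigD1 a) //= leq_addr.
have aX : #|nbrs a :&: X| + t = D by rewrite cardsID; apply/eqP/fY.
have Xa : #|X :\: nbrs a| = t by have := cardsID (nbrs a) X; rewrite setIC; lia.
pose X0 := [set x in X | nbrs x == Y].
(* Each vertex of [X] outside [X0] has a neighbor outside [Y], so it contributes to [d]. *)
have cX0 : D <= #|X0| + d.
  rewrite -cX -(cardsID X0 X) -dX.
  apply: leq_add; first by apply/subset_leq_card/subsetIr.
  rewrite [leqRHS](big_setID X0) /= -sum1_card; apply: leq_trans (leq_addl _ _).
  apply: leq_sum => x /setDP[xX]; rewrite inE xX /= => nx.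
  rewrite card_gt0 setD_eq0; apply: contra nx => sub.
  by rewrite eqEcard sub cY /=; have /eqP -> := fX x xX.
have X0a : X0 \subset nbrs a.
  by apply/subsetP => x; rewrite inE => /andP[xX /eqP nx]; rewrite nbrs_sym nx.
pose S1 := \sum_(p in nbrs a :&: X) #|nbrs p :\: Y|.
have fN : {in nbrs a :&: X, forall x, full x} by move=> x /setIP[_]; apply: fX.
have dS : d <= S1 + t * t.
  rewrite -dX (big_setID (nbrs a)) /= setIC leq_add2l -{1}Xa -sum_nat_const.
  by apply: leq_sum => x /setDP[xX _]; apply: tmax.
have S1d : S1 <= d by rewrite -dX (big_setID (nbrs a)) /= setIC leq_addr.
(* [nbrs a :&: X] sends at most [D * (D - t) - S1] edges to [Y], [nbrs a :\: X] at most [d], and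
   [d - S1 <= t * t]. *)
have light_aq q x : x \in X0 -> ends q = [set a; x] ->
    #|conflicts q| <= D * (D - t) + t * t.
  rewrite inE => /andP[xX /eqP nx] eq; rewrite (conflictsE eq) nx.
  rewrite -{1}(setID (nbrs a) X) edges_betweenUl.
  apply: leq_trans (leq_card_setU _ _) _.
  have le1 := card_edges_between_full Y fN; have := sum_nbrs_full Y fN; rewrite -/S1 => eS.
  have le2 : #|edges_between (nbrs a :\: X) Y| <= d.
    rewrite edges_betweenC; apply: leq_trans (card_edges_between_full _ fY) _.
    apply: leq_sum => y _; apply/subset_leq_card/subsetP => z /setIP[zy /setDP[_ zX]].
    by rewrite inE zX.
  have -> : D - t = #|nbrs a :&: X| by lia.
  by rewrite mulnC; lia.
exists (edges_between [set a] X0); split.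
- apply/subsetP => f /edges_betweenP[z [x [/set1P -> xX0 ef]]].
  rewrite (conflictsE ee); apply/edges_betweenP; exists a, x; split=> //.
  by move: xX0; rewrite inE => /andP[].
(* [a] is adjacent to all of [X0], so [Q] has at least [D - d] edges, while [conflicts e] has at
   most [D * D - d]. *)
- apply: leq_trans (leq_add (leqnn _) (card_nbrs_le _ _)); rewrite (setIidPr X0a).
  by move: he he' cX0; nia.
move=> q /edges_betweenP[_ [x [/set1P -> xX0 eq]]].
have cq := light_aq q x xX0 eq; rewrite /nearly_light /light.
have [t2|t1] := leqP 2 t; first by left; apply: leq_trans cq (mul_sub_sqr_le t2 _); lia.
have t1' : t = 1 by lia.
right; split; first by move: cq; rewrite t1'; lia.
have /card_gt0P[z /setDP[za zX]] := t0.
move: (za); rewrite inE => /adjacentP[g eg]; exists g.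
  by apply: (@conflict_share _ _ a); rewrite ?eq ?eg !inE eqxx.
(* Now [g] is shown light. The [D - 1] vertices of [nbrs a :&: X] send at most [d] edges each to
   [Y :&: nbrs z] and at most [S1 <= d] in all outside [Y]; [z] adds at most [D]. The total is at
   most [D * (d + 1)]. *)
have cYz : #|Y :&: nbrs z| <= d.
  rewrite /d (big_setID (nbrs z)) /= -sum1_card; apply: leq_trans (leq_addr _ _).
  apply: leq_sum => y /setIP[_ yz]; rewrite card_gt0; apply/set0Pn; exists z.
  by rewrite inE zX nbrs_sym.
rewrite /light (conflictsE eg) -(setID (nbrs a) X) edges_betweenUl.
apply: leq_trans (leq_card_setU _ _) _.
have le1 : #|edges_between (nbrs a :&: X) (nbrs z)| <= S1 + #|nbrs a :&: X| * d.
  apply: leq_trans (card_edges_between_full _ fN) _.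
  rewrite -sum_nat_const -big_split /=; apply: leq_sum => p _.
  rewrite -(cardsID Y) addnC; apply: leq_add.
    by apply/subset_leq_card/setSD/subsetIl.
  apply: leq_trans cYz; rewrite setIC; apply/subset_leq_card/setIS/subsetIr.
have le2 : #|edges_between (nbrs a :\: X) (nbrs z)| <= D.
  apply: leq_trans (card_edges_between_le _ _) _.
  apply: (@leq_trans (\sum_(p in nbrs a :\: X) D)).
    by apply: leq_sum => p _; apply: card_edges_at_le.
  by rewrite sum_nat_const -/t t1' mul1n.
have eD : #|nbrs a :&: X| * d + d = D * d by rewrite -aX t1' mulnDl mul1n.
have : D * (d + 1) <= D * (D - 1) by rewrite leq_mul2l; lia.
by rewrite mulnDr muln1; move: le1 le2 S1d eD; lia.
Qed.

(** * Recognizing a complete bipartite component *)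

Lemma full_simple x e e' : full x -> x \in ends e -> ends e = ends e' -> e = e'.
Proof.
move=> fx /ends2[y ee] ee'; have := card_edges_full [set y] fx.
have /subset_leq_card : nbrs x :&: [set y] \subset [set y] by apply: subsetIr.
rewrite cards1 => le1 le2; have /card_le1_eqP := leq_trans le2 le1.
by apply; apply/edges_betweenP; exists x, y; rewrite !inE -?ee' ee.
Qed.

(** A vertex in both [nbrs u] and [nbrs v] would neighbor itself, so these sets are disjoint; their
    union is closed under adjacency, hence the component. All pairs across are joined, and
    [full_simple] excludes parallel edges. *)
Lemma complete_component u v :
  u \in nbrs v -> full u -> full v ->
  {in nbrs u, forall y, nbrs y = nbrs v} -> {in nbrs v, forall x, nbrs x = nbrs u} ->
  isomorphic (induced (component u)) (complete_bipartite D D).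
Proof.
move=> uX fu fv NY NX; have vY : v \in nbrs u by rewrite nbrs_sym.
set X := nbrs v in uX NY NX; set Y := nbrs u in vY NY NX.
have disXY x : x \in X -> x \in Y -> False.
  by move=> xX; rewrite -(NX x xX) nbrs_irr.
have fullX x : x \in X -> full x by move=> xX; rewrite /full NX.
set S := component u.
have memS x : (x \in S) = (x \in X) || (x \in Y).
  rewrite inE; apply/idP/idP => [ux|/orP[xX|xY]].
  - have step x1 x2 : adjacent x1 x2 -> x1 \in X :|: Y -> x2 \in X :|: Y.
      move=> x12 /setUP[x1X|x1Y]; apply/setUP; [right|left].
        by rewrite -(NX _ x1X) inE.
      by rewrite -(NY _ x1Y) inE.
    have cl : closed (@adjacent G) (mem (X :|: Y)).
      by move=> x1 x2 x12; apply/idP/idP; apply: step; rewrite // adjacent_sym.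
    by have := closed_connect cl ux; rewrite /= !in_setU uX => <-.
  - apply: (@connect_trans _ _ v); apply: connect1; first by move: vY; rewrite inE.
    by move: xX; rewrite inE.
  - by apply: connect1; move: xY; rewrite inE.
have [rX [rX_inj rX_surj]] := set_ranking uX (eqP fv).
have [rY [rY_inj rY_surj]] := set_ranking vY (eqP fu).
pose f (x : induced S) : complete_bipartite D D :=
  if val x \in X then inl (rX (val x)) else inr (rY (val x)).
have fX (x : induced S) : val x \in X -> f x = inl (rX (val x)) by rewrite /f => ->.
have fY (x : induced S) : val x \in Y -> f x = inr (rY (val x)).
  by rewrite /f; case: ifP => // xX xY; case: (disXY _ xX xY).
have inS (x : induced S) : val x \in X \/ val x \in Y.
  by apply/orP; rewrite -memS; apply: valP.
have f_inj : injective f.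
  move=> x y; case: (inS x) => xS; case: (inS y) => yS;
    rewrite ?(fX _ xS) ?(fY _ xS) ?(fX _ yS) ?(fY _ yS) // => -[].
    by move/rX_inj => /(_ xS yS)/val_inj.
  by move/rY_inj => /(_ xS yS)/val_inj.
have f_surj b : exists a, f a = b.
  case: b => i.
    have [x xX <-] := rX_surj i; have xS : x \in S by rewrite memS xX.
    by exists (Sub x xS); rewrite fX SubK.
  have [x xY <-] := rY_surj i; have xS : x \in S by rewrite memS xY orbT.
  by exists (Sub x xS); rewrite fY SubK.
have endsS (e : edge (induced S)) (x y : induced S) :
    ends (val e) = [set val x; val y] -> ends e = [set x; y].
  by move=> ee; apply/setP => z; rewrite inE ee !inE.
have endsXY (e : edge (induced S)) : exists x y : induced S,
    [/\ val x \in X, val y \in Y & ends (val e) = [set val x; val y]].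
  have [x xe] : exists x, x \in ends (val e) by apply/card_gt0P; rewrite card_ends.
  have [y ee] := ends2 xe; have sub := subsetP (valP e).
  have xS : x \in S by apply: sub.
  have yS : y \in S by apply: sub; rewrite ee !inE eqxx orbT.
  have yx := ends_nbrs ee; move: (xS); rewrite memS => /orP[xX|xY].
    by exists (Sub x xS), (Sub y yS); rewrite !SubK; split=> //; rewrite -(NX x xX).
  exists (Sub y yS), (Sub x xS); rewrite !SubK; split=> //; first by rewrite -(NY x xY).
  by rewrite setUC.
have f_ends (e : edge (induced S)) (x y : induced S) :
    val x \in X -> val y \in Y -> ends (val e) = [set val x; val y] ->
    f @: ends e = @ends (complete_bipartite D D) (rX (val x), rY (val y)).
  by move=> xX yY /endsS ->; rewrite imsetU1 imset_set1 (fX _ xX) (fY _ yY).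
have [g gE] : exists g : edge (induced S) -> edge (complete_bipartite D D),
    forall e : edge (induced S), ends (g e) = f @: ends e.
  apply: (@fin_all_exists _ _ (fun (e : edge (induced S)) p => @ends (complete_bipartite D D) p = f @: ends e)).
  move=> e; have [x [y [xX yY ee]]] := endsXY e.
  by exists (rX (val x), rY (val y)); rewrite (f_ends e x y).
exists f, g; split=> //; apply: bijective_of_surj => //.
  move=> e e' gee; apply: val_inj.
  have := gE e; rewrite gee gE => /(imset_inj f_inj) eqe.
  have [x [y [xX yY ee]]] := endsXY e; have [x' [y' [xX' yY' ee']]] := endsXY e'.
  apply: (full_simple (fullX _ xX)); first by rewrite ee !inE eqxx.
  rewrite (endsS _ _ _ ee) (endsS _ _ _ ee') in eqe.
  by have := congr1 (fun A : {set induced S} => val @: A) eqe; rewrite !imsetU1 !imset_set1 ee ee'.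
move=> [i j]; have [x xX <-] := rX_surj i; have [y yY <-] := rY_surj j.
have xS : x \in S by rewrite memS xX.
have yS : y \in S by rewrite memS yY orbT.
move: (yY); rewrite -(NX x xX) inE => /adjacentP[e0 ee0].
have e0S : ends e0 \subset S by rewrite ee0 subUset !sub1set xS yS.
exists (Sub e0 e0S).
have := f_ends (Sub e0 e0S) (Sub x xS) (Sub y yS); rewrite !SubK => /(_ xX yY ee0).
rewrite -gE; case: (g _) => i' j' /= /setP eqp.
have := eqp (inl i'); have := eqp (inr j'); rewrite !inE /= !eqxx /= ?orbT.
by move=> /esym/eqP[->] /esym/orP[/eqP[->]|/eqP].
Qed.

Hypothesis no_complete_component :
  forall x, ~ isomorphic (induced (component x)) (complete_bipartite D D).

(** The ends are full by [conflicts_not_full], and a non-full neighbor of an end falls under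
    [dominated_not_full]. Otherwise [a] and [b] maximize the losses on the two sides, and the one
    with the larger loss serves in [dominated_full]; if both losses are zero, the component is
    complete bipartite. *)
Lemma heavy_dominated e : D * (D - 1) + 1 < #|conflicts e| -> dominated e.
Proof.
move=> he; have [u ue] : exists u, u \in ends e by apply/card_gt0P; rewrite card_ends.
have [v ee] := ends2 ue.
have full_e x : x \in ends e -> full x.
  move=> xe; case: (boolP (full x)) => // xF.
  by have := conflicts_not_full xe xF; move: he; lia.
have fu := full_e u ue; have fv : full v by apply: full_e; rewrite ee set22.
have vY := ends_nbrs ee; have uX : u \in nbrs v by rewrite nbrs_sym.
have ee' : ends e = [set v; u] by rewrite setUC.
case: (boolP [forall y in nbrs u, full y]) => [/forall_inP fY|]; last first.
  by rewrite negb_forall_in => /exists_inP[y yY yF]; apply: dominated_not_full ee yY yF.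
case: (boolP [forall x in nbrs v, full x]) => [/forall_inP fX|]; last first.
  by rewrite negb_forall_in => /exists_inP[x xX xF]; apply: dominated_not_full ee' xX xF.
have [a aY amax] := arg_maxnP (fun y => #|nbrs y :\: nbrs v|) vY.
have [b bX bmax] := arg_maxnP (fun x => #|nbrs x :\: nbrs u|) uX.
rewrite /= in aY amax bX bmax.
have [ba|ab] := leqP #|nbrs b :\: nbrs u| #|nbrs a :\: nbrs v|; last first.
  apply: (dominated_full ee' fv fu fX fY he bX (leq_ltn_trans (leq0n _) ab)) => y yY.
  exact: leq_trans (amax y yY) (ltnW ab).
case: (posnP #|nbrs a :\: nbrs v|) => [a0|a0]; last first.
  apply: (dominated_full ee fu fv fY fX he aY a0) => x xX.
  exact: leq_trans (bmax x xX) ba.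
have eq_nbrs x w : full x -> full w -> #|nbrs x :\: nbrs w| <= 0 -> nbrs x = nbrs w.
  move=> /eqP cx /eqP cw; rewrite leqn0 cards_eq0 setD_eq0 => sub.
  by apply/eqP; rewrite eqEcard sub cx cw /=.
case: (@no_complete_component u); apply: (complete_component uX fu fv) => [y yY|x xX].
  by apply: eq_nbrs => //; [apply: fY | rewrite -a0; apply: amax].
apply: eq_nbrs => //; first exact: fX.
by rewrite -a0; apply: leq_trans (bmax x xX) ba.
Qed.

(** * The conflict graph and its dense subgraphs *)

Definition conflict_rel e f := (e != f) && conflict e f.

Lemma conflict_rel_sym : symmetric conflict_rel.
Proof. by move=> e f; rewrite /conflict_rel eq_sym conflict_sym. Qed.

Lemma conflict_rel_irr : irreflexive conflict_rel.
Proof. by move=> e; rewrite /conflict_rel eqxx. Qed.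

Lemma conflictsU1 e : conflicts e = e |: neighbors conflict_rel e.
Proof.
apply/setP => f; rewrite in_setU1 !in_set /conflict_rel [e == f]eq_sym; case: (eqVneq f e) => [->|] //=.
by rewrite conflict_refl.
Qed.

Lemma card_conflicts e : #|conflicts e| = #|neighbors conflict_rel e|.+1.
Proof. by rewrite conflictsU1 cardsU1 inE conflict_rel_irr. Qed.

(* Otherwise every vertex would lie on [0] or [D] of the [D * (D - 1) + 1] edges
   of [C], so [D] would divide twice their number, hence [2]. *)
Lemma not_clique e (C : {set edge G}) :
  e \in C -> {in C, forall f, #|conflicts f| = D * (D - 1) + 1} ->
  {in C, forall f, conflicts f \subset C} ->
  exists a b, [/\ a \in C, b \in C, a != b & ~~ conflict_rel a b].
Proof.
move=> eC degC clC.
case: (boolP [exists a in C, exists b in C, (a != b) && ~~ conflict_rel a b]).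
  by case/exists_inP=> a aC /exists_inP[b bC /andP[]]; exists a, b.
rewrite negb_exists_in => /forall_inP clique.
have eqC : C = conflicts e.
  apply/eqP; rewrite eqEsubset clC // andbT; apply/subsetP => f fC.
  have := clique e eC; rewrite negb_exists_in => /forall_inP/(_ f fC).
  rewrite inE negb_and !negbK => /orP[/eqP <-|/andP[_] //]; exact: conflict_refl.
have cC : #|C| = D * (D - 1) + 1 by rewrite {1}eqC degC.
have : D %| \sum_(x : G) #|[set f in C | x \in ends f]|.
  apply: dvdn_sum => x _.
  have [->|/set0Pn[f]] := eqVneq [set f in C | x \in ends f] set0.
    by rewrite cards0.
  rewrite inE => /andP[fC xf]; have fx : full x.
    by apply: contraLR isT => xF; have := conflicts_not_full xf xF; rewrite degC //; lia.
  rewrite (_ : [set g in C | x \in ends g] = [set g | x \in ends g]).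
    by rewrite -[#|_|]/(degree x) degree_full.
  apply/setP => g; rewrite !inE andb_idl // => xg.
  by apply: (subsetP (clC f fC)); rewrite inE; apply: conflict_share xf xg.
rewrite (eq_bigr (fun x => \sum_(f in C) (x \in ends f))); last first.
  move=> x _; rewrite -sum1_card big_mkcond [RHS]big_mkcond; apply: eq_bigr => f _.
  by rewrite inE; case: (f \in C); case: (x \in ends f).
rewrite exchange_big /= (eq_bigr (fun=> 2)); last first.
  by move=> f _; rewrite -(card_ends f) -sum1_card [RHS]big_mkcond; apply: eq_bigr => x _; case: ifP.
rewrite sum_nat_const cC mulnDl dvdn_addr; last by rewrite -mulnA dvdn_mulr.
by move/dvdn_leq => /(_ isT); move: D3; lia.
Qed.

(** Density excludes from [V] light edges, then nearly light ones, whose conflicts would all lie in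
    [V], then heavy ones, which are dominated. So the edges of [V] have exactly [D * (D - 1)] proper
    conflicts, all in [V], and Brooks' theorem colors a connected component. *)
Lemma conflict_dense_component (V : {set edge G}) :
  V != set0 -> {in V, forall e, D * (D - 1) <= #|neighbors conflict_rel e :&: V|} ->
  exists C : {set edge G}, [/\ C \subset V, C != set0,
    {in C, forall e, neighbors conflict_rel e \subset C} &
    exists c, coloring_on conflict_rel (D * (D - 1)) C c].
Proof.
move=> /set0Pn[e0 e0V] dense.
have heavyV e : e \in V -> D * (D - 1) + 1 <= #|conflicts e :&: V|.
  move=> eV; rewrite addn1; apply: leq_ltn_trans (dense e eV) _; apply/proper_card.
  apply/properP; split; first by apply: setSI; rewrite conflictsU1 subsetUr.
  by exists e; rewrite !inE ?conflict_refl ?conflict_rel_irr.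
have lightV e : e \in V -> ~~ light e.
  move=> eV; rewrite /light -ltnNge -addn1; apply: leq_trans (heavyV e eV) _.
  exact/subset_leq_card/subsetIl.
have subV e : e \in V -> #|conflicts e| <= D * (D - 1) + 1 -> conflicts e \subset V.
  move=> eV ce; apply/setIidPl/eqP; rewrite eqEcard subsetIl /=.
  exact: leq_trans ce (heavyV e eV).
have degV e : e \in V -> #|conflicts e| = D * (D - 1) + 1.
  move=> eV; apply/eqP; rewrite eqn_leq; apply/andP; split; last first.
    exact: leq_trans (heavyV e eV) (subset_leq_card (subsetIl _ _)).
  rewrite leqNgt; apply/negP => /heavy_dominated[Q [QN cQ nearQ]].
  (* At least [D * (D - 1) + 1] members of [conflicts e] lie in [V], so fewer than [#|Q|] lie
     outside. *)
  have [q qQ qV] : exists2 q, q \in Q & q \in V.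
    apply/exists_inP; apply: contraT; rewrite negb_exists_in => /forall_inP QV.
    have : #|Q| <= #|conflicts e :\: V|.
      apply/subset_leq_card/subsetP => q qQ.
      by rewrite in_setD QV // (subsetP QN).
    by have := heavyV e eV; have := cardsID V (conflicts e); move: cQ; lia.
  have [lq|[cq [g qg lg]]] := nearQ q qQ; first by have := lightV q qV; rewrite lq.
  have gV : g \in V by apply: (subsetP (subV q qV cq)); rewrite inE.
  by have := lightV g gV; rewrite lg.
have clV e : e \in V -> conflicts e \subset V by move=> eV; apply: subV; rewrite ?degV.
have cl_connect (U : {set edge G}) (x y : edge G) :
    {in U, forall e, neighbors conflict_rel e \subset U} ->
    connect conflict_rel x y -> x \in U -> y \in U.
  move=> clU xy xU; have cl : closed conflict_rel (mem U).
    by move=> a b ab; apply/idP/idP => zU; apply: (subsetP (clU _ zU));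
      rewrite inE // conflict_rel_sym.
  by have := closed_connect cl xy; rewrite /= xU.
have clVn : {in V, forall e, neighbors conflict_rel e \subset V}.
  by move=> e eV; apply: subset_trans (clV e eV); rewrite conflictsU1 subsetUr.
pose C := [set f | connect conflict_rel e0 f].
have CV : C \subset V.
  by apply/subsetP => f; rewrite inE => ef; apply: (cl_connect V e0).
have e0C : e0 \in C by rewrite inE.
have clC : {in C, forall e, neighbors conflict_rel e \subset C}.
  move=> e; rewrite inE => ee; apply/subsetP => f; rewrite !inE => ef.
  exact: connect_trans ee (connect1 ef).
exists C; split=> //; first by apply/set0Pn; exists e0.
have [|f fC|a [b [aC bC ab nab]]] := @not_clique e0 C e0C.
- by move=> f /(subsetP CV)/degV.
- rewrite conflictsU1 subUset sub1set fC; exact: clC.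
have [|||c cC] := brooks conflict_rel_sym conflict_rel_irr _ clC _ _ aC bC ab nab (k := D * (D - 1)).
- by move: D3; nia.
- move=> U UC /set0Pn[x xU] clU; apply/eqP; rewrite eqEsubset UC /=.
  apply/subsetP => y; rewrite inE => ey; apply: (cl_connect U x) => //.
  apply: connect_trans ey; rewrite (sym_connect_sym conflict_rel_sym).
  by have := subsetP UC x xU; rewrite inE.
- by move=> f fC; have := degV f (subsetP CV f fC); rewrite card_conflicts; lia.
by exists c.
Qed.

(** * From the conflict graph to a [B]-coloring *)

Lemma conflict_opposite x0 x1 x2 x3 e0 e1 e2 e3 :
  ends e0 = [set x0; x1] -> ends e1 = [set x1; x2] ->
  ends e2 = [set x2; x3] -> ends e3 = [set x3; x0] -> conflict e0 e2.
Proof.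
move=> h0 h1 h2 h3; rewrite (conflictE _ h0); apply/edges_betweenP; exists x3, x2.
by rewrite nbrs_sym (ends_nbrs h3) (ends_nbrs h1) h2 setUC.
Qed.

Lemma B_colorable_max_degree : B_colorable G (D * (D - 1)).
Proof.
have [c [ck cp]] := colorable_of_dense_sets
  conflict_rel_sym conflict_rel_irr conflict_dense_component [set: edge G].
have c_lt e : c e < D * (D - 1) by apply: ck.
pose C := [ffun e => Ordinal (c_lt e)].
have C_neq e f : e != f -> conflict e f -> C e != C f.
  by move=> ef cf; rewrite !ffunE -val_eqE; apply: cp; rewrite // /conflict_rel ef.
apply/existsP; exists C; apply/andP; split.
  apply/forallP => e; apply/forallP => f; apply/implyP => /andP[ef /set0Pn[x /setIP[xe xf]]].
  by apply: C_neq => //; apply: conflict_share xe xf.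
apply/forallP => x0; apply/forallP => x1; apply/forallP => x2; apply/forallP => x3.
apply/forallP => e0; apply/forallP => e1; apply/forallP => e2; apply/forallP => e3.
apply/implyP => cyc; have := four_cycle_uniq cyc.
case/and5P: cyc => _ /eqP h0 /eqP h1 /eqP h2 /eqP h3.
rewrite /= !inE !negb_or !andbT => /and3P[/and3P[n01 n02 n03] /andP[n12 n13] n23].
rewrite !C_neq //.
- by apply: (@conflict_share _ _ x3); rewrite ?h2 ?h3 !inE eqxx ?orbT.
- exact: (conflict_opposite h1 h2 h3 h0).
- by apply: (@conflict_share _ _ x2); rewrite ?h1 ?h2 !inE eqxx ?orbT.
- by apply: (@conflict_share _ _ x0); rewrite ?h0 ?h3 !inE eqxx ?orbT.
- exact: (conflict_opposite h0 h1 h2 h3).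
- by apply: (@conflict_share _ _ x1); rewrite ?h0 ?h1 !inE eqxx ?orbT.
Qed.

End Conflicts.

Theorem theorem1p3 (D : nat) (G : multigraph) :
  3 <= D ->
  max_degree G <= D ->
  (forall x : G,
     ~ isomorphic (induced (component x)) (complete_bipartite D D)) ->
  q_B G <= D * (D - 1).
Proof.
move=> D3 maxD noK; rewrite /q_B; case: ex_minnP => q _; apply.
exact: B_colorable_max_degree.
Qed.
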